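(* There is an absolute constant $c>0$ such that the following holds. Let $C\subseteq\{0,1\}^n$ be a binary linear code and let $G$ be a generating matrix of $C$ over $\mathbb F_2$ with columns $v_1,\dots,v_n$. Let $p$ be the maximal multiplicity of a column in $G$ (i.e., $p=\max_i |\{j : v_j=v_i\}|$). Let $\sigma$ be a positive integer with $\sigma>p$ such that every coordinate $i\in[n]$ participates in at least $\sigma$ linear dependencies of length three, i.e., there are at least $\sigma$ two-element sets $\{j,k\}\subseteq[n]\setminus\{i\}$ with $v_i+v_j+v_k=0$. Then, writing $s=\lceil \sigma/p\rceil$, \[ \dim(C)\le c\,\frac{\log s}{s}\, n . \]
   Context: A generating matrix of $C$ is a matrix over $\mathbb F_2$ whose row space is $C$. The paper states the conclusion as $\dim(C)\le O\!\left(\frac{\log\lceil\sigma/p\rceil}{\lceil\sigma/p\rceil}\, n\right)$. *)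

(* Defs.v *)
From HB Require Import structures.
From mathcomp Require Import all_boot all_order all_algebra.
From mathcomp Require Import reals exp.

Set Implicit Arguments.
Unset Strict Implicit.
Unset Printing Implicit Defensive.

Import Order.TTheory GRing.Theory Num.Theory.
Local Open Scope ring_scope.

(* The rows of G span C, but need not be linearly independent. *)
Definition generating_matrix (k n : nat) (C : {vspace 'rV['F_2]_n})
    (G : 'M['F_2]_(k, n)) : Prop :=
  forall x : 'rV['F_2]_n, (x \in C) = (x <= G)%MS.

Definition max_col_multiplicity (k n : nat) (G : 'M['F_2]_(k, n)) : nat :=
  \max_(i < n) #|[set j : 'I_n | col j G == col i G]|.

(* The dependencies are counted by pairs of column indices, so equal columns
   at different positions give different dependencies. *)
Definition deps3 (k n : nat) (G : 'M['F_2]_(k, n)) (i : 'I_n) :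
    {set {set 'I_n}} :=
  [set A : {set 'I_n} | [&& #|A| == 2%N, i \notin A &
    col i G + \sum_(j in A) col j G == 0]].

(* Main.v *)
(* Grow a subspace V of the column space, and let the level of a column be the
   truncated logarithm of the number of columns in its coset modulo V, capped
   at L.  If v_i is outside V and every dependency v_i = v_x + v_y involves a
   column of level < L, then adding v_i to V merges the cosets of v_x and v_y,
   so the smaller one doubles and its level increases; as each column lies in
   at most p of the at least sigma dependencies, the sum of the levels, which
   never exceeds n L, grows by at least sigma / p.  When no such v_i is left,
   every column is in the span of V and one representative of each of the at
   most n / 2^L cosets of level L.  Hence dim C <= n L p / sigma + n / 2^L, and
   L is taken to be about log s. *)
Require Import Defs.
From mathcomp Require Import all_boot all_order all_algebra.
From mathcomp Require Import reals exp.
From mathcomp Require Import zify lra.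

Set Implicit Arguments.
Unset Strict Implicit.

Import Order.TTheory GRing.Theory Num.Theory.
Local Open Scope ring_scope.

(** * Classes of columns modulo a subspace, and their levels *)

Section CosetClasses.
Variables (F : fieldType) (n k : nat) (v : 'I_n -> 'rV[F]_k).
Implicit Types (V : 'M[F]_k) (x y : 'I_n) (L : nat).

Definition coset_class V x : {set 'I_n} := [set y | (v y - v x <= V)%MS].

Definition level L V x : nat := minn L (trunc_log 2 #|coset_class V x|).

Definition potential L V : nat := (\sum_x level L V x)%N.

Lemma coset_class_refl V x : x \in coset_class V x.
Proof. by rewrite inE subrr sub0mx. Qed.

Lemma coset_class_eq V x y :
  y \in coset_class V x -> coset_class V y = coset_class V x.
Proof.
rewrite inE => yx; apply/setP => z; rewrite !inE.
apply/idP/idP => h.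
- by rewrite -(subrKA (v y)) addmx_sub.
- by rewrite -(subrKA (v x)) addmx_sub // -opprB eqmx_opp.
Qed.

Lemma coset_class_gt0 V x : (0 < #|coset_class V x|)%N.
Proof. by apply/card_gt0P; exists x; apply: coset_class_refl. Qed.

Lemma coset_classS V W x :
  (V <= W)%MS -> coset_class V x \subset coset_class W x.
Proof. by move=> VW; apply/subsetP => y; rewrite !inE => /submx_trans; apply. Qed.

Lemma level_mono L V W x : (V <= W)%MS -> (level L V x <= level L W x)%N.
Proof.
move=> VW; rewrite leq_min geq_minl /=.
by apply: leq_trans (geq_minr _ _) _; apply/leq_trunc_log/subset_leq_card/coset_classS.
Qed.

(** Doubling a nonempty class raises its truncated binary logarithm by at least one, and the cap
    cannot absorb the gain while the level is still below [L]. *)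
Lemma level_doubling L V W x :
  (#|coset_class V x| + #|coset_class V x| <= #|coset_class W x|)%N ->
  (level L V x < L)%N -> (level L V x < level L W x)%N.
Proof.
move=> dbl; rewrite /level => sml.
have := leq_trunc_log 2 dbl.
rewrite addnn trunc_log2_double ?coset_class_gt0 //; lia.
Qed.

Lemma level_merge L V W x y :
  (V <= W)%MS -> ~~ (v x - v y <= V)%MS -> (v x - v y <= W)%MS ->
  (level L V x < L)%N || (level L V y < L)%N ->
  (level L V x < level L W x)%N || (level L V y < level L W y)%N.
Proof.
move=> VW xyV xyW.
have dis : [disjoint coset_class V x & coset_class V y].
  apply/pred0P => z /=; apply: contraNF xyV => /andP[zx zy].
  have := coset_class_refl V x.
  by rewrite -(coset_class_eq zx) (coset_class_eq zy) inE.
have cW : coset_class W x = coset_class W y by apply: coset_class_eq; rewrite inE.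
have : (#|coset_class V x| + #|coset_class V y| <= #|coset_class W x|)%N.
  rewrite -cardsUI (disjoint_setI0 dis) cards0 addn0 subset_leq_card //.
  by rewrite subUset {2}cW !coset_classS.
wlog le_xy : x y xyV xyW dis cW / (#|coset_class V x| <= #|coset_class V y|)%N.
  move=> hw; case/orP: (leq_total #|coset_class V x| #|coset_class V y|) => le.
    exact: hw.
  rewrite addnC cW orbC (orbC (level L V x < level L W x)%N); apply: hw => //.
  - by rewrite -opprB eqmx_opp.
  - by rewrite -opprB eqmx_opp.
  - by rewrite disjoint_sym.
move=> sum sml; apply/orP; left; apply: level_doubling.
  exact: leq_trans (leq_add (leqnn _) le_xy) sum.
(* The smaller class also has the smaller level, so if either level is below [L], that of [x] is. *)
have := leq_trunc_log 2 le_xy; move: sml; rewrite /level; lia.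
Qed.

Lemma potential_gain L V W : (V <= W)%MS ->
  (potential L V + #|[set x | level L V x < level L W x]%N| <= potential L W)%N.
Proof.
move=> VW; rewrite -sum1dep_card big_mkcond -big_split /=.
apply: leq_sum => x _; case: ifP => h; first by rewrite addn1.
by rewrite addn0 level_mono.
Qed.

Lemma potential_le L V : (potential L V <= n * L)%N.
Proof.
rewrite -[X in (X * _)%N]card_ord -sum_nat_const.
by apply: leq_sum => x _; apply: geq_minl.
Qed.

(** * Representatives of the classes of level [L] *)

Definition class_repr V x : 'I_n := odflt x [pick y in coset_class V x].

Lemma class_repr_in V x : class_repr V x \in coset_class V x.
Proof.
rewrite /class_repr; case: pickP => //= h.
by have := h x; rewrite coset_class_refl.
Qed.

Lemma class_repr_eq V x y :
  y \in coset_class V x -> class_repr V y = class_repr V x.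
Proof.
move=> yx; rewrite /class_repr (coset_class_eq yx).
by case: pickP => //= /(_ x); rewrite coset_class_refl.
Qed.

Definition full_reprs L V : {set 'I_n} :=
  [set class_repr V x | x in [set x | level L V x == L]].

(** The fibres of [class_repr V] partition the [n] indices, and the fibre over a representative of a
    class of level [L] contains that whole class. *)
Lemma card_full_reprs L V : (#|full_reprs L V| * 2 ^ L <= n)%N.
Proof.
rewrite -sum_nat_const -[X in (_ <= X)%N]card_ord -sum1_card.
rewrite [X in (_ <= X)%N](partition_big (class_repr V) xpredT) //=.
rewrite big_mkcond; apply: leq_sum => r _; case: ifP => // /imsetP[x + ->].
rewrite inE => /eqP lx.
apply: (@leq_trans #|coset_class V x|).
  apply: leq_trans (trunc_logP (ltnSn 1) (coset_class_gt0 V x)).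
  by rewrite leq_exp2l // -lx geq_minr.
rewrite sum1dep_card subset_leq_card //.
by apply/subsetP => y /class_repr_eq; rewrite inE => ->.
Qed.

Definition full_span L V : 'M[F]_k :=
  (V + \sum_(r in full_reprs L V) <<v r>>)%MS.

Lemma rank_full_span L V : (\rank (full_span L V) <= \rank V + #|full_reprs L V|)%N.
Proof.
apply: leq_trans (mxrank_adds_leqif _ _).1 _; rewrite leq_add2l.
apply: leq_trans (mxrank_sum_leqif _).1 _ => /=.
by rewrite -sum1_card; apply: leq_sum => r _; rewrite genmxE rank_leq_row.
Qed.

Lemma sub_full_span L V x : level L V x = L -> (v x <= full_span L V)%MS.
Proof.
move=> lx; rewrite -(subrK (v (class_repr V x)) (v x)) addmx_sub //.
  apply: submx_trans (addsmxSl _ _).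
  by have := class_repr_in V x; rewrite inE -opprB eqmx_opp.
apply: submx_trans (addsmxSr _ _); rewrite -(genmxE (v _)).
apply: (sumsmx_sup (class_repr V x)) => //.
by apply: imset_f; rewrite inE lx.
Qed.

End CosetClasses.

(** * Dependencies over the two-element field and the growth of the subspace *)

Lemma addmx_F2 (m n : nat) (A : 'M['F_2]_(m, n)) : A + A = 0.
Proof. by apply/matrixP => i j; rewrite !mxE addrr_pchar2 ?pchar_Fp. Qed.

Section ThreeTermDependencies.
Variables (k n : nat) (G : 'M['F_2]_(k, n)).
Let p := max_col_multiplicity G.
Let v (i : 'I_n) : 'rV['F_2]_k := (col i G)^T.

Lemma deps3_pair i A : A \in deps3 G i ->
  exists x y, A = [set x; y] /\ col x G + col y G = col i G.
Proof.
rewrite inE => /and3P[/cards2P[x [y [xy ->]]] _].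
rewrite big_setU1 ?inE //= big_set1 addr_eq0 => /eqP ->.
exists x, y; split => //.
by apply/eqP; rewrite -subr_eq0 opprK addmx_F2.
Qed.

Lemma card_eq_col (u : 'cV['F_2]_k) : (#|[set y | col y G == u]| <= p)%N.
Proof.
have [->|[y]] := set_0Vmem [set y | col y G == u]; first by rewrite cards0.
by rewrite inE => /eqP <-; apply: (leq_bigmax y).
Qed.

(** Once a member [x] in [U] of a dependency is chosen, the column of its partner is forced, which
    leaves at most [p] partners. *)
Lemma deps3_cover i (U : {set 'I_n}) :
  (forall x y, col x G + col y G = col i G -> (x \in U) || (y \in U)) ->
  (#|deps3 G i| <= p * #|U|)%N.
Proof.
move=> cov; pose T x := [set y | col y G == col i G - col x G].
apply: (@leq_trans #|\bigcup_(x in U) [set [set x; y] | y in T x]|).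
  apply/subset_leq_card/subsetP => A /deps3_pair[x [y [-> xy]]].
  have Ty : y \in T x by rewrite inE -xy addrC addKr.
  have Tx : x \in T y by rewrite inE -xy addrK.
  case/orP: (cov _ _ xy) => h; apply/bigcupP; first by exists x; last exact: imset_f.
  by exists y => //; rewrite setUC; apply: imset_f.
rewrite mulnC -sum_nat_const.
elim/big_ind2: _ => [|A a B b hA hB|x _]; first by rewrite cards0.
  by apply: leq_trans (leq_add hA hB); rewrite cardsU leq_subr.
exact: leq_trans (leq_imset_card _ _) (card_eq_col _).
Qed.

Lemma potential_step (L : nat) (V : 'M['F_2]_k) i :
  ~~ (v i <= V)%MS ->
  (forall x y, col x G + col y G = col i G ->
     (level v L V x < L)%N || (level v L V y < L)%N) ->
  (p * potential v L V + #|deps3 G i| <= p * potential v L (V + <<v i>>)%MS)%N.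
Proof.
move=> viV small; set W := (V + _)%MS.
have VW : (V <= W)%MS by apply: addsmxSl.
apply: leq_trans (leq_mul (leqnn p) (potential_gain _ _ VW)).
rewrite mulnDr leq_add2l; apply: deps3_cover => x y xy; rewrite !inE.
(* In characteristic 2 the sum is also the difference, so adding [v i] merges the classes of [x] and
   [y]. *)
have vxy : v x - v y = v i.
  rewrite /v -xy [(col x G + _)^T]linearD /=; congr (_ + _).
  by apply/eqP; rewrite eq_sym -addr_eq0 addmx_F2.
apply: level_merge => //; rewrite ?vxy //; last exact: small.
by apply: submx_trans (addsmxSr _ _); rewrite genmxE.
Qed.

(** Each growth step raises the rank by at most 1 and [p * potential] by at least [sigma]. This
    keeps the rank inequality and shrinks the gap to the ceiling [p * (n * L)], on which the
    induction runs. *)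
Lemma exists_full_span (sigma L : nat) : (0 < sigma)%N ->
  (forall i, sigma <= #|deps3 G i|)%N ->
  exists2 V : 'M['F_2]_k, (\rank V * sigma <= p * potential v L V)%N
    & forall i, (v i <= full_span v L V)%MS.
Proof.
move=> s0 hs.
suff grow m (V : 'M['F_2]_k) : (p * (n * L) - p * potential v L V < m)%N ->
    (\rank V * sigma <= p * potential v L V)%N ->
    exists2 V : 'M['F_2]_k, (\rank V * sigma <= p * potential v L V)%N
      & forall i, (v i <= full_span v L V)%MS.
  by apply: (grow _ 0 (ltnSn _)); rewrite mxrank0.
elim: m V => // m IHm V hm hV.
have [/existsP[i /andP[viV /forallP small]] | stuck] :=
  boolP [exists i, ~~ (v i <= V)%MS && [forall x, forall y,
    (col x G + col y G == col i G) ==>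
    ((level v L V x < L)%N || (level v L V y < L)%N)]].
  have step : (p * potential v L V + #|deps3 G i| <=
      p * potential v L (V + <<v i>>)%MS)%N.
    apply: potential_step => // x y /eqP xy.
    by have /forallP/(_ y)/implyP/(_ xy) := small x.
  have hi := hs i.
  have hW := leq_mul (leqnn p) (potential_le v L (V + <<v i>>)%MS).
  apply: (IHm (V + <<v i>>)%MS); first lia.
  have : (\rank (V + <<v i>>)%MS <= \rank V + 1)%N.
    apply: leq_trans (mxrank_adds_leqif _ _).1 _.
    by rewrite leq_add2l genmxE rank_leq_row.
  by move=> /leq_mul/(_ (leqnn sigma)); lia.
exists V => // i; have [viV|viV] := boolP (v i <= V)%MS.
  exact: submx_trans viV (addsmxSl _ _).
(* No growth through [i] is possible, so some dependency of [v i] has both members at level [L],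
   hence in the full span. *)
move: stuck; rewrite negb_exists => /forallP/(_ i); rewrite viV /=.
case/forallPn => x /forallPn[y]; rewrite negb_imply negb_or -!leqNgt.
case/and3P => /eqP xy lx ly.
have full z : (L <= level v L V z)%N -> (v z <= full_span v L V)%MS.
  by move=> lz; apply: sub_full_span; apply/eqP; rewrite eqn_leq lz geq_minl.
by rewrite /v -xy [(col x G + _)^T]linearD addmx_sub // full.
Qed.

(** After multiplication by [s], the rank of [V] contributes at most [2 * n * L], and the
    representatives at most [n] since [s <= 2 ^ L]. *)
Lemma rank_deps3_bound (sigma s : nat) : (0 < sigma)%N -> (0 < p)%N ->
  (forall i, sigma <= #|deps3 G i|)%N -> (p * s <= 2 * sigma)%N ->
  (\rank G * s <= n * (2 * up_log 2 s + 1))%N.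
Proof.
move=> s0 p0 hs ps; set L := up_log 2 s.
have [V hV full] := exists_full_span L s0 hs.
have Gsub : (G^T <= full_span v L V)%MS.
  by apply/row_subP => i; rewrite -tr_col full.
have := leq_trans (mxrankS Gsub) (rank_full_span v L V); rewrite mxrank_tr => hr.
have hP := leq_mul (leqnn p) (potential_le v L V).
have hR := card_full_reprs v L V.
have sL : (s <= 2 ^ L)%N by apply: up_logP.
have hRs : (#|full_reprs v L V| * s <= n)%N.
  exact: leq_trans (leq_mul (leqnn _) sL) hR.
have hVs : (\rank V * s <= 2 * (n * L))%N.
  rewrite -(leq_pmul2l p0).
  have : (\rank V * (p * s) <= \rank V * (2 * sigma))%N by rewrite leq_mul2l ps orbT.
  lia.
apply: leq_trans (leq_mul hr (leqnn s)) _; lia.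
Qed.
End ThreeTermDependencies.

(** * Passage to the dimension and to natural logarithms *)

Lemma dim_generating_matrix (k n : nat) (C : {vspace 'rV['F_2]_n})
    (G : 'M['F_2]_(k, n)) : generating_matrix C G -> (\dim C <= \rank G)%N.
Proof.
move=> CG; pose B := [seq row i (row_base G) | i <- enum 'I_(\rank G)].
have sB : size B = \rank G by rewrite size_map size_enum_ord.
rewrite -sB; apply: leq_trans (dim_span B); apply/dimvS/subvP => x.
rewrite CG -(eq_row_base G) => /submxP[D ->].
rewrite mulmx_sum_row; apply: memv_suml => i _; apply/memvZ/memv_span.
by apply: map_f; rewrite mem_enum.
Qed.

(** With [L = up_log 2 s], write [2 * L + 1] as [2 * (L - 1) + 3]; both [(L - 1) * ln 2] and [ln 2]
    are at most [ln s], which gives 5. *)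
Lemma up_log_ln (R : realType) (s : nat) : (1 < s)%N ->
  (2 * up_log 2 s + 1)%:R * ln 2 <= 5 * ln (s%:R : R).
Proof.
move=> s1; set L := up_log 2 s.
have L0 : (0 < L)%N by rewrite up_log_gt0.
have ln2s : ln 2 <= ln (s%:R : R) by rewrite ler_ln ?posrE ?ltr0n ?ler_nat //; lia.
have : L.-1%:R * ln 2 <= ln (s%:R : R).
  rewrite mulr_natl -lnXn ?ltr0n // ler_ln ?posrE ?exprn_gt0 ?ltr0n //; last lia.
  by rewrite -natrX ler_nat ltnW // up_log_gtn.
rewrite natrD natrM; move: ln2s; have -> : L%:R = L.-1%:R + 1 :> R by rewrite natr1 prednK.
nra.
Qed.

Unset Implicit Arguments.
Set Strict Implicit.

Theorem theorem1p6 (R : realType) :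
  exists c : R, 0 < c /\
    forall (n k : nat) (C : {vspace 'rV['F_2]_n}) (G : 'M['F_2]_(k, n))
      (p sigma : nat),
      generating_matrix C G ->
      p = max_col_multiplicity G ->
      (0 < sigma)%N ->
      (p < sigma)%N ->
      (forall i : 'I_n, (sigma <= #|deps3 G i|)%N) ->
      let s : R := (Num.ceil (sigma%:R / p%:R : R))%:~R in
      (\dim C)%:R <= c * (ln s / s) * n%:R.
Proof.
have ln2 : 0 < ln (2 : R) by rewrite ln_gt0 // ltr1n.
exists (5 / ln 2); split; first by rewrite divr_gt0.
move=> n k C G p sigma CG pG s0 ps hs; cbv zeta.
have dimG := dim_generating_matrix CG.
(* For [n = 0] there is no column and [p = 0], but both sides of the bound vanish. *)
have [n0|n0] := posnP n.
  have -> : \dim C = 0%N by have := leq_trans dimG (rank_leq_col G); lia.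
  by rewrite n0 mulr0.
have p0 : (0 < p)%N.
  rewrite pG; apply: leq_trans (leq_bigmax (Ordinal n0)).
  by apply/card_gt0P; exists (Ordinal n0); rewrite inE.
have pR : 0 < p%:R :> R by rewrite ltr0n.
have sigp : 1 < sigma%:R / p%:R :> R by rewrite ltr_pdivlMr // mul1r ltr_nat.
have /andP[] := ceil_itv (sigma%:R / p%:R : R).
have [t tE] : exists t : nat, Num.ceil (sigma%:R / p%:R : R) = t%:Z.
  exists `|Num.ceil (sigma%:R / p%:R : R)|%N; rewrite gez0_abs // ceil_ge0; lra.
rewrite tE rmorphB /= -pmulrn => ub lb.
have t1 : (1 < t)%N by rewrite -(ltr_nat R); lra.
(* The ceiling is below [sigma / p + 1], and [1 < sigma / p]; hence the factor 2. *)
have pt : (p * t <= 2 * sigma)%N.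
  rewrite -(ler_nat R) !natrM mulrC -ler_pdivlMr // -mulrA; lra.
have t0 : 0 < t%:R :> R by rewrite ltr0n; lia.
have hr : (\rank G * t <= n * (2 * up_log 2 t + 1))%N.
  by apply: rank_deps3_bound hs _; rewrite // -pG.
rewrite mulrA mulrAC ler_pdivlMr // [5 / _]mulrC -!mulrA ler_pdivlMl //.
rewrite mulrA [X in _ <= X]mulrA.
(* With denominators cleared, this middle term links the rank bound [hr] to [up_log_ln]. *)
apply: le_trans (_ : n%:R * ((2 * up_log 2 t + 1)%:R * ln 2) <= _); last first.
  by rewrite mulrC ler_wpM2r // up_log_ln.
rewrite -mulrA [X in X <= _]mulrC [X in _ <= X]mulrA ler_wpM2r ?(ltW ln2) //.
rewrite -!natrM ler_nat; apply: leq_trans hr.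
by rewrite leq_mul2r dimG orbT.
Qed.
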